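(* Let $\alpha>-1$, $\beta>0$, and let $\mathcal{B}_k^{(\alpha)}$, $k\ge0$, be the coefficients associated with the first passage time $T$ as defined in the context. Then for all $k\ge1$ $$\mathcal{B}_k^{(\alpha)}=\sum_{j=1}^k\binom{k}{j}(-1)^{j+1}\mathcal{B}_{k-j}^{(\alpha)}+\frac{(-\beta)^k\,\mathbb{E}[T^k]}{(\alpha+k)_k}.$$
   Context: Setting: $W$ is a standard Brownian motion, $\sigma>0$, $\mu>\sigma^2/2$, $y_0>0$, and $Y(t)=y_0\,e^{(\mu-\sigma^2/2)t+\sigma W(t)}$, $t\ge 0$, is the geometric Brownian motion. $S$ is a constant with $S>y_0$, and $T=\inf\{t\ge 0: Y(t)>S\}$; all moments of $T$ are finite. Notation: $(x)_n=\prod_{j=0}^{n-1}(x-j)$ is the lowering factorial. The coefficients are $\mathcal{B}_0^{(\alpha)}=1$ and $$\mathcal{B}_k^{(\alpha)}=1+\sum_{j=1}^k\binom{k}{j}\frac{(-\beta)^j\,\mathbb{E}[T^j]}{(\alpha+j)_j},\qquad k\ge1.$$ *)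

(* Defs.v *)
From HB Require Import structures.
From mathcomp Require Import all_boot all_order all_algebra.
From mathcomp Require Import all_classical all_reals all_analysis.
Set Implicit Arguments.
Unset Strict Implicit.
Unset Printing Implicit Defensive.
Import Order.TTheory GRing.Theory Num.Theory.
Import numFieldNormedType.Exports.
Local Open Scope classical_set_scope.
Local Open Scope ring_scope.

Section brownian.
Context {d : measure_display} {Omega : measurableType d} {R : realType}.
Variable P : probability Omega R.

(* Product rule over the whole finite family; subfamilies are covered by
   taking [B i = setT] for the other indices. *)
Definition mutually_independent (I : finType) (X : I -> Omega -> R) : Prop :=
  forall B : I -> set R, (forall i, measurable (B i)) ->
    P (\bigcap_(i in [set: I]) (X i @^-1` B i))
    = (\prod_(i : I) P (X i @^-1` B i))%E.

(* Time is indexed by the whole of [R], but only times [0 <= t] are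
   constrained or used. [normal_prob m s] is parameterized by the standard
   deviation [s]. *)
Record standard_brownian_motion (W : R -> {RV P >-> R}) : Prop := {
  bm_start : {ae P, forall w, W 0 w = 0};
  bm_indep_increments : forall (n : nat) (t : nat -> R),
    0 <= t 0%N -> (forall i, (i < n)%N -> t i <= t i.+1) ->
    mutually_independent (fun (i : 'I_n) w => W (t i.+1) w - W (t i) w);
  bm_gaussian_increments : forall s t : R, 0 <= s -> s < t ->
    forall B : set R, measurable B ->
      P ((fun w => W t w - W s w) @^-1` B)
      = normal_prob 0 (Num.sqrt (t - s)) B;
  bm_continuous : {ae P, forall w,
    {within `[0, +oo[, continuous (fun t => W t w)}} }.

Definition geometric_brownian_motion (W : R -> Omega -> R) (mu sigma y0 : R)
    (t : R) (w : Omega) : R :=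
  y0 * expR ((mu - sigma ^+ 2 / 2) * t + sigma * W t w).

(* Extended-real valued: the infimum of the empty set is [+oo]. *)
Definition first_passage_time (Y : R -> Omega -> R) (S : R) (w : Omega)
    : \bar R :=
  ereal_inf [set t%:E | t in [set t : R | 0 <= t /\ S < Y t w]].

(* The expectation of [T ^ j] as a real number. The integral is computed in
   [\bar R], as [T] may be infinite on a null set; [fine] is the identity on
   its value when the moment is finite. *)
Definition moment (T : Omega -> \bar R) (j : nat) : R :=
  fine (\int[P]_w (T w ^+ j)%E).

End brownian.

Definition lowering_factorial {R : realType} (x : R) (n : nat) : R :=
  \prod_(0 <= j < n) (x - j%:R).

(* [m j] stands for the [j]-th moment; for [k = 0] the sum is empty and the
   value is 1. *)
Definition Bcoef {R : realType} (alpha beta : R) (m : nat -> R) (k : nat) : R :=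
  1 + \sum_(1 <= j < k.+1)
        'C(k, j)%:R * ((- beta) ^+ j * m j / lowering_factorial (alpha + j%:R) j).

(* Main.v *)
Require Import Defs.
From HB Require Import structures.
From mathcomp Require Import all_boot all_order all_algebra.
From mathcomp Require Import all_classical all_reals all_analysis.
Set Implicit Arguments.
Unset Strict Implicit.
Unset Printing Implicit Defensive.
Import Order.TTheory GRing.Theory Num.Theory.
Import numFieldNormedType.Exports.
Local Open Scope classical_set_scope.
Local Open Scope ring_scope.

(** Let [L] be the linear functional on polynomials sending [X^i] to [a i], where
    [a i] is the factor of ['C(k, i)] in the sum defining [B k] (with [a 0 = 1]).
    Then [B m = L ((X + 1)^m)], and the recursion is [L] applied to the binomial
    expansion of [X^k = ((X + 1) - 1)^k]. *)

Lemma coef_X1n (A : comNzRingType) (n i : nat) :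
  (('X + 1) ^+ n : {poly A})`_i = 'C(n, i)%:R.
Proof.
(* Swapping the summands makes [exprDn] raise ['X] to the summation index itself. *)
rewrite addrC exprDn coef_sum.
under eq_bigr => j _ do rewrite expr1n mul1r coefMn coefXn.
have [lin|ltni] := ltnP i n.+1; last first.
  rewrite bin_small // big1 // => j _.
  by rewrite gtn_eqF ?mul0rn // (leq_trans (ltn_ord j)).
rewrite (bigD1 (Ordinal lin)) //= eqxx big1 ?addr0 // => j.
by rewrite eq_sym -val_eqE /= => /negbTE ->; rewrite mul0rn.
Qed.

Lemma binomial_inversion (A : comNzRingType) (a : nat -> A) (k : nat) :
  \sum_(j < k.+1) 'C(k, j)%:R * (-1) ^+ j *
    \sum_(i < (k - j).+1) 'C(k - j, i)%:R * a i = a k.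
Proof.
(* Cutting the functional off at degree [k] loses nothing: only polynomials of degree at most [k]
   occur, whence [m <= k] in [LX1]. *)
pose L (p : {poly A}) := \sum_(i < k.+1) p`_i * a i.
have LX : L 'X^k = a k.
  rewrite /L (bigD1 ord_max) //= coefXn eqxx mul1r big1 ?addr0 // => i.
  by rewrite -val_eqE coefXn /= => /negbTE ->; rewrite mul0r.
have LX1 m : (m <= k)%N ->
    L (('X + 1) ^+ m) = \sum_(i < m.+1) 'C(m, i)%:R * a i.
  move=> lemk; rewrite /L.
  under eq_bigr => i _ do rewrite coef_X1n.
  rewrite [RHS](big_ord_widen k.+1 (fun i => 'C(m, i)%:R * a i)) //.
  rewrite [RHS]big_mkcond; apply: eq_bigr => i _.
  by case: ltnP => // ltmi; rewrite bin_small ?mul0r.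
rewrite -LX -['X in RHS](addrK 1) exprDn /L.
under [RHS]eq_bigr => i _ do rewrite coef_sum mulr_suml.
rewrite exchange_big /=; apply: eq_bigr => j _.
rewrite -LX1 ?leq_subr // /L mulr_sumr; apply: eq_bigr => i _.
(* As a constant polynomial, the sign factors out of each coefficient. *)
have -> : (-1) ^+ j = ((-1) ^+ j)%:P :> {poly A} by rewrite rmorphXn rmorphN1.
by rewrite coefMn coefMC -[in RHS]mulr_natl -!mulrA [(_ ^+ j) * _]mulrCA.
Qed.

Theorem proposition4p1 (R : realType) (d : measure_display)
    (Omega : measurableType d) (P : probability Omega R)
    (W : R -> {RV P >-> R}) (mu sigma y0 S alpha beta : R) :
  standard_brownian_motion W ->
  0 < sigma -> sigma ^+ 2 / 2 < mu -> 0 < y0 -> y0 < S ->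
  -1 < alpha -> 0 < beta ->
  let Y := geometric_brownian_motion W mu sigma y0 in
  let T := first_passage_time Y S in
  let B := Bcoef alpha beta (moment P T) in
  forall k : nat, (1 <= k)%N ->
    B k = \sum_(1 <= j < k.+1) 'C(k, j)%:R * (-1) ^+ j.+1 * B (k - j)%N
          + (- beta) ^+ k * moment P T k
            / lowering_factorial (alpha + k%:R) k.
Proof.
move=> _ _ _ _ _ _ _ Y T B k k_gt0.
(* With [a 0] set to 1 by cases, the leading 1 of [Bcoef] becomes the term [i = 0], and the zeroth
   moment need not be evaluated. *)
pose a j : R := if j is 0%N then 1 else
  (- beta) ^+ j * moment P T j / lowering_factorial (alpha + j%:R) j.
have BE m : B m = \sum_(i < m.+1) 'C(m, i)%:R * a i.
  rewrite -(big_mkord xpredT (fun i => 'C(m, i)%:R * a i)) big_ltn //=.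
  rewrite bin0 mulr1 /B /Bcoef; congr (_ + _).
  by apply: eq_big_nat => -[].
have -> : (- beta) ^+ k * moment P T k / lowering_factorial (alpha + k%:R) k
    = a k by case: k k_gt0.
(* Once [a k] is expanded, the [j = 0] term of the inversion is [B k]; for [j >= 1] its terms are
   the negatives of those in the recursion, by the shift from [j] to [j.+1] in the sign, so
   everything else cancels. *)
rewrite -(binomial_inversion a k).
under [X in _ = _ + X]eq_bigr => j _ do rewrite -BE.
rewrite -(big_mkord xpredT
  (fun j => 'C(k, j)%:R * (-1) ^+ j * B (k - j)%N)) [X in _ = _ + X]big_ltn //.
rewrite bin0 expr0 !mul1r subn0 addrCA -big_split /= big1 ?addr0 // => j _.
by rewrite exprS mulN1r mulrN mulNr addNr.
Qed.
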